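(* Let $n\ge1$. For every $A\in\mathrm{Sym}^2(\mathbb{R}^{n+1})$ and every $V\in\mathbb{R}^{n\times1}$, $$\widetilde\Theta(A)=\widetilde\Theta(A_V),\qquad\text{where}\quad A_V:=\begin{pmatrix}1&0\\ V&I\end{pmatrix}A\begin{pmatrix}1&V^T\\ 0&I\end{pmatrix}\in\mathrm{Sym}^2(\mathbb{R}^{n+1})$$ and $I$ is the $n\times n$ identity matrix.
   Context: $\mathrm{Sym}^2(\mathbb{R}^k)$ is the space of real symmetric $k\times k$ matrices. For $B\in\mathrm{Sym}^2(\mathbb{R}^n)$ with eigenvalues $\lambda_1(B),\dots,\lambda_n(B)$, let $\widetilde\theta(B):=\sum_{i=1}^n\tan^{-1}\lambda_i(B)$, with $\tan^{-1}:\mathbb{R}\to(-\frac{\pi}{2},\frac{\pi}{2})$. For $A\in\mathrm{Sym}^2(\mathbb{R}^{n+1})$ let $A^+\in\mathrm{Sym}^2(\mathbb{R}^n)$ be the lower-right $n\times n$ block. Let $I_n:=\mathrm{diag}(0,1,\dots,1)\in\mathrm{Sym}^2(\mathbb{R}^{n+1})$ and $\mathcal{S}:=\{\mathrm{diag}(0,A^+):A^+\in\mathrm{Sym}^2(\mathbb{R}^n)\}$. The lifted space-time Lagrangian angle $\widetilde\Theta:\mathrm{Sym}^2(\mathbb{R}^{n+1})\to\mathbb{R}$ is $\widetilde\Theta(A):=\sum_{i=1}^{n+1}\arg\big(\lambda_i(I_n+\sqrt{-1}A)\big)$ for $A\notin\mathcal{S}$ (eigenvalues counted with multiplicity; for $A\notin\mathcal{S}$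 they lie in $\mathbb{C}\setminus(-\infty,0]$, and $\arg:\mathbb{C}\setminus(-\infty,0]\to(-\pi,\pi)$ is the angle with the positive real axis), and $\widetilde\Theta(A):=\widetilde\theta(A^+)+\frac{\pi}{2}$ for $A\in\mathcal{S}$. *)

(* Defs.v *)
From HB Require Import structures.
From mathcomp Require Import all_boot all_order all_algebra.
From mathcomp Require Import all_classical all_reals all_analysis.
From mathcomp Require Import complex.

Set Implicit Arguments.
Unset Strict Implicit.
Unset Printing Implicit Defensive.

Import Order.TTheory GRing.Theory Num.Theory.

Local Open Scope classical_set_scope.
Local Open Scope ring_scope.

(* The roots in F of the characteristic polynomial of M, each repeated according
   to its algebraic multiplicity. The list is determined up to permutation if
   char_poly M splits over F, which it does when F = R[i] and when M is a real
   symmetric matrix; otherwise it is [::]. *)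
Definition eigenvalues (F : fieldType) (n : nat) (M : 'M[F]_n) : seq F :=
  xget [::] [set s : seq F | char_poly M = \prod_(z <- s) ('X - z%:P)].

(* The angle in ]-pi, pi[ between z and the positive real axis; meaningful only
   off the half-line ]-oo, 0], where such an angle exists and is unique. *)
Definition arg (R : realType) (z : R[i]) : R :=
  xget 0 [set t : R | - pi < t < pi /\
    z = `|z| * Complex (cos t) (sin t)].

Definition theta (R : realType) (n : nat) (B : 'M[R]_n) : R :=
  \sum_(l <- eigenvalues B) atan l.

Definition spaceI (R : realType) (n : nat) : 'M[R]_(1 + n) :=
  block_mx 0 0 0 1%:M.

Definition degenerate (R : realType) (n : nat) : set 'M[R]_(1 + n) :=
  [set A | exists2 B : 'M[R]_n, B \is symmetricmx & A = block_mx 0 0 0 B].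

(* Only the values at symmetric matrices are meaningful. *)
Definition Theta (R : realType) (n : nat) (A : 'M[R]_(1 + n)) : R :=
  if A \in @degenerate R n then theta (drsubmx A) + pi / 2
  else \sum_(z <- eigenvalues (map_mx (real_complex R) (spaceI R n)
                               + Complex 0 1 *: map_mx (real_complex R) A))
         arg z.

Definition shear (R : realType) (n : nat) (V : 'cV[R]_n) (A : 'M[R]_(1 + n)) :
    'M[R]_(1 + n) :=
  block_mx 1%:M 0 V 1%:M *m A *m block_mx 1%:M V^T 0 1%:M.

(* Main.v *)
Require Import Defs.
From mathcomp Require Import all_boot all_order all_algebra.
From mathcomp Require Import all_classical all_reals all_analysis.
From mathcomp Require Import complex ring lra.
Set Implicit Arguments.
Unset Strict Implicit.
Unset Printing Implicit Defensive.
Import Order.TTheory GRing.Theory Num.Theory.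
Import numFieldNormedType.Exports.
Local Open Scope ring_scope.

(** A shear [shear V A = P *m A *m P^T], with [P] unimodular and fixing the
form [spaceI], turns [M = spaceI + i A] into [M' = P *m M *m P^T].  So
[\det M = \det M'], and the two sums of arguments of eigenvalues agree modulo
[2 pi]; the point is to show that they agree exactly.

If [A] is degenerate, then [shear V A = A].  Otherwise [M] and [M'] are
invertible and accretive (the form [w M w^*] has nonnegative real part), so
their eigenvalues lie in the closed right half-plane minus the origin.  For
[0 <= s <= 1] let [N s = (1 - s) M + s], whose determinant is the product of
the factors [(1 - s) z + s] over the eigenvalues [z] of [M]; each factor stays
in the right half-plane and ends at [1].  Hence the sum of the arguments of
the eigenvalues is, up to sign, the change of a continuous argument of
[\det (N s)] from [s = 0] to [s = 1], and similarly for
[N' s = (1 - s) M' + s].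

The two determinants are compared through a third one.  With the real vectors
[u = (1, - V)] and [v = (1, V)] one has [P (1 + u u^T) P^T = 1 + v v^T]
([shear_rank1]), so that
[\det (N s + s u u^T) = \det (N' s + s v v^T)], a polynomial [W] in [s].  The
quotient [W s / \det (N s)] equals [1 + s u^T (N s)^-1 u], which has real part
at least [1] because the inverse of an accretive matrix is accretive
([accretive_rank1]).  So this quotient never turns around the origin; it is
positive at [s = 0] and at [s = 1].  The same holds for [N'].

The factors [(1 - s) z' + s], the conjugates of the [(1 - s) z + s], and the
two comparison terms (the first one conjugated) are therefore polynomial paths
in the right half-plane that end on the positive axis and whose product is
positive throughout.  The sum of their arguments is continuous, a multiple of
[2 pi], and zero at [s = 1]; so it is zero at [s = 0] ([sum_arg_homotopy]).
There the comparison terms contribute nothing, and what is left is the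
difference of the two sums of arguments. *)

(** * Arguments in the right half-plane *)

Lemma sum_sqr_gt0 (R : realDomainType) (x y : R) :
  ~~ ((x == 0) && (y == 0)) -> 0 < x ^+ 2 + y ^+ 2.
Proof.
move=> xy0; rewrite lt0r paddr_eq0 ?sqr_ge0 // !sqrf_eq0 xy0.
by rewrite addr_ge0 ?sqr_ge0.
Qed.

Lemma mulC_conj_ge0 (R : realType) (z : R[i]) : 0 <= z * z^*%C.
Proof.
by case: z => a b; simpc; rewrite mulrC addNr eqxx addr_ge0 // -expr2 sqr_ge0.
Qed.

Lemma mulC_conj_gt0 (R : realType) (z : R[i]) : z != 0 -> 0 < z * z^*%C.
Proof.
by move=> z0; rewrite lt_def mulC_conj_ge0 mulf_eq0 conjc_eq0 orbb z0.
Qed.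

(** Equal cosines force [s = t] or [s = - t], and in the second case equal sines
force [sin t = 0], which on the open interval leaves only [t = 0]. *)
Lemma cos_sin_inj (R : realType) (s t : R) : - pi < s < pi -> - pi < t < pi ->
  cos s = cos t -> sin s = sin t -> s = t.
Proof.
have abs_itv (u : R) : - pi < u < pi -> `|u| \in `[0, pi].
  by move=> /andP[u1 u2]; rewrite in_itv /= normr_ge0 /= ler_norml !ltW.
have cos_abs (u : R) : cos `|u| = cos u.
  by case: (leP 0 u) => u0; [rewrite ger0_norm | rewrite ltr0_norm ?cosN].
move=> sI tI cst sst.
have /cos_inj : cos `|s| = cos `|t| by rewrite !cos_abs.
move=> /(_ (abs_itv _ sI) (abs_itv _ tI)) /eqP.
rewrite eqr_norm2 => /orP[/eqP //|/eqP sNt].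
move: sst; rewrite sNt sinN => sint.
have sin0 : sin t = 0 by lra.
case: (ltgtP t 0) => [t0|t0|->]; last by rewrite oppr0.
- have /sin_gt0_pi : 0 < - t < pi by lra.
  by rewrite sinN sin0 oppr0 ltxx.
- have /sin_gt0_pi : 0 < t < pi by lra.
  by rewrite sin0 ltxx.
Qed.

Definition cis (R : realType) (t : R) : R[i] := Complex (cos t) (sin t).

Lemma cisD (R : realType) (s t : R) : cis (s + t) = cis s * cis t.
Proof. by rewrite /cis; simpc; rewrite cosD sinD; congr Complex; ring. Qed.

Lemma normC_cis (R : realType) (t : R) : `|cis t| = 1.
Proof. by rewrite normc_def /= cos2Dsin2 sqrtr1. Qed.

Lemma arg_polar (R : realType) (r t : R) : 0 < r -> - pi < t < pi ->
  arg (r%:C%C * cis t) = t.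
Proof.
move=> r0 tI; rewrite /arg; apply: xget_unique => [|s [sI]].
  split=> //; rewrite normrM normC_cis mulr1 ger0_norm //.
  by rewrite lecR ltW.
rewrite normrM normC_cis mulr1 ger0_norm ?lecR 1?ltW //.
have r0' : r%:C%C != 0 :> R[i] by rewrite eq_complex /= gt_eqF.
by move=> /(mulfI r0') [cst sst]; apply: cos_sin_inj.
Qed.

(** This region contains the eigenvalues of every invertible accretive matrix,
and it is preserved by conjugation and by the segments to [1]. *)
Definition half_plane (R : realType) (z : R[i]) : bool :=
  (0 <= complex.Re z) && (z != 0).

(** The half-angle formula for the argument of [x + i y].  A single expression
valid on the whole closed right half-plane, the imaginary axis included, makes
the argument visibly continuous there, as [atan (y / x)] would not. *)
Definition atan2 (R : realType) (x y : R) : R :=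
  2 * atan (y / (Num.sqrt (x ^+ 2 + y ^+ 2) + x)).

Lemma half_plane_denom (R : realType) (x y : R) : half_plane (Complex x y) ->
  0 < Num.sqrt (x ^+ 2 + y ^+ 2) + x.
Proof.
rewrite /half_plane eq_complex /= => /andP[x0 xy0].
by apply: ltr_pwDl => //; rewrite sqrtr_gt0 sum_sqr_gt0.
Qed.

Lemma polar_atan2 (R : realType) (x y : R) : half_plane (Complex x y) ->
  Complex x y = (Num.sqrt (x ^+ 2 + y ^+ 2))%:C%C * cis (atan2 x y).
Proof.
move=> hz; have d0 := half_plane_denom hz.
move: hz; rewrite /half_plane eq_complex /= => /andP[x0 xy0].
rewrite /atan2; set r := Num.sqrt _ in d0 *; set u := y / _.
have rr : r ^+ 2 = x ^+ 2 + y ^+ 2 by rewrite sqr_sqrtr // addr_ge0 ?sqr_ge0.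
have u1 : 0 < 1 + u ^+ 2 by rewrite ltr_pwDl // sqr_ge0.
(* With [u] the tangent of the half-angle, this identity computes
   [1 + u ^+ 2], hence the squared cosine [c2] of the half-angle. *)
have rx : (r + x) ^+ 2 + y ^+ 2 = 2 * r * (r + x).
  have -> : y ^+ 2 = r ^+ 2 - x ^+ 2 by rewrite rr; ring.
  by ring.
have c2 : cos (atan u) ^+ 2 = (r + x) / (2 * r).
  rewrite cos_atan exprVn sqr_sqrtr ?ltW //.
  rewrite /u.
  have -> : 1 + (y / (r + x)) ^+ 2 = (2 * r) / (r + x).
    apply: (@mulIf _ ((r + x) ^+ 2)); first by rewrite expf_neq0 // gt_eqF.
    rewrite mulrDl mul1r exprMn exprVn divfK ?expf_neq0 ?gt_eqF // rx expr2.
    by rewrite mulrA divfK ?gt_eqF.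
  by rewrite invf_div.
have su : sin (atan u) = u * cos (atan u).
  have cu : cos (atan u) != 0.
    by rewrite gt_eqF // cos_gt0_pihalf // atan_gtNpi2 atan_ltpi2.
  by rewrite -{2}(atanK u) /tan divfK.
have r0 : r != 0 by rewrite gt_eqF // sqrtr_gt0 sum_sqr_gt0.
have dn0 : r + x != 0 by rewrite gt_eqF.
rewrite /cis mulr_natl mulr2n cosD sinD su -!expr2 exprMn.
have -> : u * cos (atan u) * cos (atan u) + cos (atan u) * (u * cos (atan u)) =
          2 * u * cos (atan u) ^+ 2 by ring.
rewrite c2; simpc; congr Complex; rewrite /u.
- have -> : r * ((r + x) / (2 * r) - (y / (r + x)) ^+ 2 * ((r + x) / (2 * r))) =
     ((r + x) ^+ 2 - y ^+ 2) / (2 * (r + x)) by field; rewrite dn0 r0.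
  have -> : (r + x) ^+ 2 - y ^+ 2 = x * (2 * (r + x)).
    have -> : y ^+ 2 = r ^+ 2 - x ^+ 2 by rewrite rr; ring.
    by ring.
  by rewrite mulfK // mulf_neq0 ?pnatr_eq0.
- by field; rewrite dn0 r0.
Qed.

Lemma arg_half_plane (R : realType) (x y : R) : half_plane (Complex x y) ->
  arg (Complex x y) = atan2 x y.
Proof.
move=> hz; rewrite {1}(polar_atan2 hz) arg_polar //.
  move: hz; rewrite /half_plane eq_complex /= => /andP[_ xy0].
  by rewrite sqrtr_gt0 sum_sqr_gt0.
rewrite /atan2; set u := _ / _.
have := atan_gtNpi2 u; have := atan_ltpi2 u; lra.
Qed.

Lemma polar_arg (R : realType) (z : R[i]) : half_plane z ->
  z = `|z| * cis (arg z).
Proof.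
by case: z => x y hz; rewrite arg_half_plane // {1}polar_atan2 // normc_def.
Qed.

Lemma half_plane_conj (R : realType) (z : R[i]) :
  half_plane z -> half_plane z^*%C.
Proof. by rewrite /half_plane conjc_eq0; case: z. Qed.

Lemma arg_conj (R : realType) (z : R[i]) : half_plane z ->
  arg z^*%C = - arg z.
Proof.
move=> hz; have := half_plane_conj hz; case: z hz => x y hz hz'.
by rewrite !arg_half_plane //= /atan2 sqrrN mulNr atanN mulrN.
Qed.

Lemma arg_gt0 (R : realType) (z : R[i]) : 0 < z -> arg z = 0.
Proof.
case: z => x y; rewrite ltcE /= => /andP[/eqP -> x0].
rewrite arg_half_plane; last by rewrite /half_plane eq_complex /= ltW // gt_eqF.
by rewrite /atan2 mul0r atan0 mulr0.
Qed.

Lemma prod_polar (R : realType) (zs : seq R[i]) : all (@half_plane R) zs ->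
  \prod_(z <- zs) z = `|\prod_(z <- zs) z| * cis (\sum_(z <- zs) arg z).
Proof.
elim: zs => [_|z zs IH /= /andP[hz /IH zsE]].
  by rewrite !big_nil normr1 mul1r /cis cos0 sin0.
by rewrite !big_cons normrM cisD mulrACA -zsE -polar_arg.
Qed.

(** The multiplicativity of arguments modulo [2 pi], in the one form needed: the
arguments of numbers with positive product sum to a multiple of [2 pi]. *)
Lemma prod_gt0_cos_sum_arg (R : realType) (zs : seq R[i]) :
  all (@half_plane R) zs -> 0 < \prod_(z <- zs) z ->
  cos (\sum_(z <- zs) arg z) = 1.
Proof.
move=> /prod_polar; set p := \prod_(z <- zs) z => pE p0; move: pE.
rewrite gtr0_norm // -{1}[p]mulr1 => /mulfI.
by rewrite gt_eqF // => /(_ isT) [].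
Qed.

(** * A homotopy criterion for sums of arguments *)

Lemma continuous_ReIm_horner (R : realType) (p : {poly R[i]}) :
  continuous (fun s : R => complex.Re p.[s%:C%C]) /\
  continuous (fun s : R => complex.Im p.[s%:C%C]).
Proof.
elim/poly_ind: p => [|p c [cRe cIm]].
  by split => s; under eq_fun do rewrite horner0 /=; exact: cst_continuous.
have eRe s : complex.Re (p * 'X + c%:P).[s%:C%C] =
    complex.Re p.[s%:C%C] * s + complex.Re c.
  by rewrite hornerMXaddC; case: (p.[_]) => a b; case: (c) => c1 c2 /=; ring.
have eIm s : complex.Im (p * 'X + c%:P).[s%:C%C] =
    complex.Im p.[s%:C%C] * s + complex.Im c.
  by rewrite hornerMXaddC; case: (p.[_]) => a b; case: (c) => c1 c2 /=; ring.
split => s.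
- under eq_fun do rewrite eRe.
  by apply: cvgD; [apply: cvgM; [exact: cRe|exact: cvg_id]|exact: cvg_cst].
- under eq_fun do rewrite eIm.
  by apply: cvgD; [apply: cvgM; [exact: cIm|exact: cvg_id]|exact: cvg_cst].
Qed.

Lemma continuous_arg_horner (R : realType) (p : {poly R[i]}) (s : R) :
  half_plane p.[s%:C%C] ->
  {for s, continuous (fun t : R =>
     atan2 (complex.Re p.[t%:C%C]) (complex.Im p.[t%:C%C]))}.
Proof.
have [cRe cIm] := continuous_ReIm_horner p.
move: (cRe s) (cIm s).
set x := fun t : R => complex.Re _; set y := fun t : R => complex.Im _.
move=> cx cy hp.
have d0 : Num.sqrt (x s ^+ 2 + y s ^+ 2) + x s != 0.
  by rewrite gt_eqF // half_plane_denom // /x /y; case: (p.[_]) hp.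
rewrite /atan2.
apply: (@continuousM _ _ (fun=> 2) (fun t =>
   atan (y t / (Num.sqrt (x t ^+ 2 + y t ^+ 2) + x t)))).
  exact: cst_continuous.
apply: (@continuous_comp _ _ _ (fun t =>
  (y t / (Num.sqrt (x t ^+ 2 + y t ^+ 2) + x t))) (@atan R)); last first.
  exact: continuous_atan.
apply: (@continuousM _ _ y (fun t =>
  (Num.sqrt (x t ^+ 2 + y t ^+ 2) + x t)^-1)) => //.
apply: continuousV => //.
apply: (@continuousD _ _ _ (fun t => Num.sqrt (x t ^+ 2 + y t ^+ 2)) x) => //.
apply: (@continuous_comp _ _ _ (fun t => x t ^+ 2 + y t ^+ 2) Num.sqrt).
  by apply: (@continuousD _ _ _ (x \* x) (y \* y)); apply: continuousM.
exact: sqrt_continuous.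
Qed.

(** Along the paths, the sum of the arguments is continuous with cosine [1]
and vanishes at time [1].  If it did not vanish at time [0], the intermediate
value theorem would give it a value of absolute value in [(0, pi]], where the
cosine is not [1]. *)
Lemma sum_arg_homotopy (R : realType) (ps : seq {poly R[i]}) :
  (forall p s, p \in ps -> 0 <= s <= 1 -> half_plane p.[s%:C%C]) ->
  (forall p, p \in ps -> 0 < p.[1]) ->
  (forall s, 0 <= s <= 1 -> 0 < \prod_(p <- ps) p.[s%:C%C]) ->
  \sum_(p <- ps) arg p.[0] = 0.
Proof.
move=> hps ps1 psprod.
pose f (p : {poly R[i]}) (s : R) :=
  atan2 (complex.Re p.[s%:C%C]) (complex.Im p.[s%:C%C]).
pose T s := \sum_(p <- ps) f p s.
have TE s : 0 <= s <= 1 -> T s = \sum_(p <- ps) arg p.[s%:C%C].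
  move=> sI; apply: eq_big_seq => p pin; rewrite /f.
  by case: (p.[_]) (hps p s pin sI) => x y h; rewrite arg_half_plane.
have cosT s : 0 <= s <= 1 -> cos (T s) = 1.
  move=> sI; rewrite TE // -(big_map (fun p => p.[s%:C%C]) predT (@arg R)).
  apply: prod_gt0_cos_sum_arg; last by rewrite big_map psprod.
  by apply/allP => _ /mapP[p pin ->]; exact: hps.
have T1 : T 1 = 0.
  rewrite TE ?ler01 ?lexx // big_seq big1 // => p /ps1 p1.
  exact: arg_gt0.
have cT : ({within `[0, 1], continuous T})%classic.
  apply: continuous_in_subspaceT => s; rewrite inE /= in_itv /= => sI.
  have cf p : p \in ps -> {for s, continuous (f p)}.
    by move=> pin; apply: continuous_arg_horner; exact: hps.
  rewrite /T; elim: (ps) cf => [_|p qs IH cf].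
    have -> : (fun t => \sum_(p <- [::]) f p t) = fun=> 0.
      by apply/funext => t; rewrite big_nil.
    exact: cst_continuous.
  have -> : (fun t => \sum_(q <- p :: qs) f q t) =
            f p \+ (fun t => \sum_(q <- qs) f q t).
    by apply/funext => t; rewrite big_cons.
  apply: continuousD; first by apply: cf; rewrite mem_head.
  by apply: IH => q qin; apply: cf; rewrite in_cons qin orbT.
suff : T 0 = 0 by rewrite TE // lexx ler01.
apply/eqP/negPn/negP => T0.
have attains v : Num.min (T 0) 0 <= v <= Num.max (T 0) 0 -> cos v = 1.
  rewrite -{2 4}T1 => /(IVT ler01 cT)[s].
  by rewrite in_itv /= => sI <-; exact: cosT.
have pi0 : 0 < pi :> R := pi_gt0 R.
pose v := Num.min `|T 0| pi.
have v0 : 0 < v by rewrite lt_min normr_gt0 T0.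
have vle : v <= `|T 0| /\ v <= pi by rewrite !ge_min !lexx ?orbT.
have : cos v = 1.
  case: (ltP (T 0) 0) vle => T00 [vT _].
    rewrite -cosN; apply: attains.
    move: vT; rewrite ltr0_norm // => vT.
    by rewrite ge_min le_max lerNr vT oppr_le0 (ltW v0) orbT.
  apply: attains; move: vT; rewrite ger0_norm // => vT.
  by rewrite ge_min le_max vT (ltW v0) orbT.
have [_ vpi] := vle.
rewrite -cos0 => /cos_inj; rewrite !in_itv /= lexx (ltW v0) vpi (ltW pi0).
by move=> /(_ isT isT) v00; rewrite v00 ltxx in v0.
Qed.

(** * Accretive matrices and rank one updates *)

Definition conjT (R : realType) (m : nat) (w : 'rV[R[i]]_m) : 'cV[R[i]]_m :=
  (map_mx (@conjc R) w)^T.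

Definition hform (R : realType) (m : nat) (M : 'M[R[i]]_m) (w : 'rV[R[i]]_m) :
    R[i] :=
  (w *m M *m conjT w) 0 0.

Definition accretive (R : realType) (m : nat) (M : 'M[R[i]]_m) : Prop :=
  forall w : 'rV[R[i]]_m, 0 <= complex.Re (hform M w).

Lemma conjTK (R : realType) (m : nat) (w : 'rV[R[i]]_m) :
  (map_mx (@conjc R) (conjT w))^T = w.
Proof. by apply/matrixP => i j; rewrite !mxE; exact: conjcK. Qed.

Lemma hnorm_ge0 (R : realType) (m : nat) (w : 'rV[R[i]]_m) :
  0 <= (w *m conjT w) 0 0.
Proof.
by rewrite mxE sumr_ge0 // => j _; rewrite !mxE; exact: mulC_conj_ge0.
Qed.

Lemma hnorm_eq0 (R : realType) (m : nat) (w : 'rV[R[i]]_m) :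
  (w *m conjT w) 0 0 = 0 -> w = 0.
Proof.
rewrite mxE => /eqP; rewrite psumr_eq0 => [/allP w0|j _]; last first.
  by rewrite !mxE; exact: mulC_conj_ge0.
apply/rowP => j; have := w0 j; rewrite mem_index_enum => /(_ isT).
by rewrite !mxE mulf_eq0 conjc_eq0 orbb => /eqP.
Qed.

Lemma hnorm_gt0 (R : realType) (m : nat) (w : 'rV[R[i]]_m) :
  w != 0 -> 0 < (w *m conjT w) 0 0.
Proof.
move=> w0; rewrite lt_def hnorm_ge0 andbT.
by apply: contra w0 => /eqP/hnorm_eq0->.
Qed.

(** [Y] is Hermitian, so its form takes real values. *)
Lemma hform_real_sym (R : realType) (m : nat) (Y : 'M[R]_m)
    (w : 'rV[R[i]]_m) : Y^T = Y ->
  complex.Im (hform (map_mx (real_complex R) Y) w) = 0.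
Proof.
move=> Ysym; set h := hform _ _.
have : h^*%C = h; last first.
  by case: h => a b [] /= bN; lra.
rewrite /h /hform.
set Z := map_mx _ Y.
have Zc : map_mx (@conjc R) Z = Z.
  by apply/matrixP => i j; rewrite !mxE /= oppr0.
have Zt : Z^T = Z.
  by apply/matrixP => i j; rewrite !mxE -[in RHS]Ysym mxE.
transitivity ((map_mx (@conjc R) (w *m Z *m conjT w))^T 0 0).
  by rewrite !mxE.
by rewrite !map_mxM Zc trmx_mul trmx_mul Zt mulmxA conjTK.
Qed.

Lemma hformD (R : realType) (m : nat) (M N : 'M[R[i]]_m) w :
  hform (M + N) w = hform M w + hform N w.
Proof. by rewrite /hform mulmxDr mulmxDl mxE. Qed.

Lemma hformZ (R : realType) (m : nat) (M : 'M[R[i]]_m) a w :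
  hform (a *: M) w = a * hform M w.
Proof. by rewrite /hform -scalemxAr -scalemxAl mxE. Qed.

Lemma accretiveD (R : realType) (m : nat) (M N : 'M[R[i]]_m) :
  accretive M -> accretive N -> accretive (M + N).
Proof.
move=> hM hN w; rewrite hformD.
have := hM w; have := hN w.
by case: (hform M w) => a b; case: (hform N w) => c d /= *; rewrite addr_ge0.
Qed.

Lemma accretiveZ (R : realType) (m : nat) (M : 'M[R[i]]_m) (a : R) :
  0 <= a -> accretive M -> accretive (a%:C%C *: M).
Proof.
move=> a0 hM w; rewrite hformZ; have := hM w.
by case: (hform M w) => c d /= *; rewrite mul0r subr0 mulr_ge0.
Qed.

Lemma accretive1 (R : realType) (m : nat) : accretive (1%:M : 'M[R[i]]_m).
Proof.
move=> w; rewrite /hform mulmx1; have := hnorm_ge0 w.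
by rewrite lecE /= => /andP[].
Qed.

(** At a left eigenvector [w] the form is [z] times the positive number
[w w^*]. *)
Lemma accretive_eigenvalue (R : realType) (m : nat) (M : 'M[R[i]]_m) z :
  accretive M -> eigenvalue M z -> 0 <= complex.Re z.
Proof.
move=> hM /eigenvalueP[w wM w0]; have := hM w.
rewrite /hform wM -scalemxAl mxE; have := hnorm_gt0 w0; rewrite ltcE /=.
case: ((w *m conjT w) 0 0) => a b; case: z {wM} => c d /= /andP[/eqP -> a0].
by rewrite mulr0 subr0 pmulr_lge0.
Qed.

(** Multiplying the block matrix with rows [(1 + u w, u)] and [(0, 1)] by
unitriangular matrices on both sides turns its diagonal blocks [1 + u w] and
[1] into [1] and [1 + w u]. *)
Lemma det_1_add_outer (F : fieldType) (m : nat) (u : 'cV[F]_m)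
    (w : 'rV[F]_m) : \det (1%:M + u *m w) = 1 + (w *m u) 0 0.
Proof.
pose L : 'M[F]_(m + 1) := block_mx 1%:M 0 w 1%:M.
pose L' : 'M[F]_(m + 1) := block_mx 1%:M 0 (- w) 1%:M.
have : L *m block_mx (1%:M + u *m w) u 0 1%:M *m L' =
    block_mx 1%:M u 0 (1%:M + w *m u).
  rewrite !mulmx_block !mul0mx !mul1mx !mulmx1 !mulmx0 !addr0 !add0r.
  rewrite !mulmxN addrK mulmxDr mulmx1 mulmxDl mul1mx mulmxA.
  by rewrite [X in X - _]addrC subrr [w *m u + _]addrC.
move/(congr1 (fun X => \det X)); rewrite !det_mulmx !det_lblock !det_ublock.
by rewrite !det1 !mul1r !mulr1 det_mx11 mxE mxE eqxx => ->.
Qed.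

Lemma det_rank1_update (F : fieldType) (m : nat) (M : 'M[F]_m)
    (u : 'cV[F]_m) (w : 'rV[F]_m) : M \in unitmx ->
  \det (M + u *m w) = \det M * (1 + (w *m invmx M *m u) 0 0).
Proof.
move=> Mu; rewrite -mulmxA -det_1_add_outer -det_mulmx mulmxDr mulmx1.
by rewrite mulmxA mulKVmx.
Qed.

(** By [det_rank1_update] the ratio of the two determinants is
[1 + s u^T M^-1 u].  With [w = u^T M^-1], the number [u^T M^-1 u = w u] is the
conjugate of the form of [M] at [w], as [u] is real; so the ratio has real part
at least [1].  The ratio is written as a product with a conjugate in order to
remain polynomial in the entries. *)
Lemma accretive_rank1 (R : realType) (m : nat) (M : 'M[R[i]]_m) (u : 'cV[R]_m)
    (s : R) (U := map_mx (real_complex R) u) :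
  accretive M -> \det M != 0 -> 0 <= s ->
  0 < complex.Re (\det (M + s%:C%C *: (U *m U^T)) * (\det M)^*%C).
Proof.
move=> hM M0 s0.
have Mu : M \in unitmx by rewrite unitmxE unitfE.
rewrite scalemxAl det_rank1_update // -scalemxAr mxE.
pose w := U^T *m invmx M.
have -> : (U^T *m invmx M *m U) 0 0 = (hform M w)^*%C.
  rewrite -/w.
  have -> : U = conjT (w *m M).
    rewrite /conjT /w mulmxKV //; apply/matrixP => i j; rewrite !mxE /=.
    by rewrite oppr0.
  transitivity ((map_mx (@conjc R) (w *m M *m conjT w))^T 0 0); last first.
    by rewrite /hform [LHS]mxE [LHS]mxE.
  by rewrite map_mxM trmx_mul conjTK.
have := hM w; case: (hform M w) => a b /= a0.
case: (\det M) M0 => c d; rewrite eq_complex /= => cd0.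
rewrite [ltRHS](_ : _ = (1 + s * a) * (c ^+ 2 + d ^+ 2)); last by ring.
rewrite mulr_gt0 //; first by rewrite ltr_pwDl // mulr_ge0.
exact: sum_sqr_gt0.
Qed.

(** If [a != 0], this is the characteristic polynomial at [- b / a]; if [a = 0],
it only says that there are [m] eigenvalues. *)
Lemma det_affine_eigenvalues (F : fieldType) (m : nat) (M : 'M[F]_m)
    (zs : seq F) (a b : F) : char_poly M = \prod_(z <- zs) ('X - z%:P) ->
  \det (a *: M + b%:M) = \prod_(z <- zs) (a * z + b).
Proof.
move=> ME.
have sz : size zs = m.
  by apply/eqP; rewrite -eqSS -(size_char_poly M) ME size_prod_XsubC.
have [->|a0] := eqVneq a 0.
  rewrite scale0r add0r det_scalar -sz.
  under eq_bigr do rewrite mul0r add0r.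
  by rewrite big_const_seq count_predT iter_mulr_1.
have -> : a *: M + b%:M = (- a) *: ((- (b / a))%:M - M).
  rewrite scalerBr [X in _ - X]scaleNr opprK addrC; congr (_ + _).
  by rewrite scale_scalar_mx mulrNN mulrC divfK.
rewrite detZ.
have -> : \det ((- (b / a))%:M - M) = (char_poly M).[- (b / a)].
  rewrite /char_poly -horner_evalE -det_map_mx; congr (\det _).
  apply/matrixP => i j; rewrite !mxE /= /horner_eval.
  by rewrite !hornerE hornerMn hornerX.
rewrite ME horner_prod -sz -(count_predT zs) -iter_mulr_1 -big_const_seq.
rewrite -big_split /=; apply: eq_bigr => z _.
by rewrite hornerXsubC mulrBr mulrNN mulrC divfK // mulNr opprK addrC.
Qed.

(** * Arguments of the eigenvalues of accretive matrices *)

(** With [U] the vector [u], this is [(1 - s) M + s] updated by the rank one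
matrix [s U U^T]: the matrix that can be compared both with [M] and, after a
change of variables, with a congruent matrix. *)
Definition rank1_pencil (R : realType) (m : nat) (M : 'M[R[i]]_m)
    (u : 'cV[R]_m) (s : R[i]) : 'M[R[i]]_m :=
  let U := map_mx (real_complex R) u in
  (1 - s) *: M + s *: (1%:M + U *m U^T).

Definition rank1_pencil_poly (R : realType) (m : nat) (M : 'M[R[i]]_m)
    (u : 'cV[R]_m) : {poly R[i]} :=
  let U := map_mx (real_complex R) u in
  \det ((1 - 'X) *: map_mx polyC M + 'X *: map_mx polyC (1%:M + U *m U^T)).

Lemma horner_rank1_pencil (R : realType) (m : nat) (M : 'M[R[i]]_m)
    (u : 'cV[R]_m) (s : R[i]) :
  (rank1_pencil_poly M u).[s] = \det (rank1_pencil M u s).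
Proof.
rewrite -horner_evalE -det_map_mx; congr (\det _).
apply/matrixP => i j; rewrite !mxE /= /horner_eval.
by rewrite !hornerE.
Qed.

Definition segment_poly (R : realType) (z : R[i]) : {poly R[i]} :=
  (1 - 'X) * z%:P + 'X.

Lemma horner_segment (R : realType) (z s : R[i]) :
  (segment_poly z).[s] = (1 - s) * z + s.
Proof. by rewrite /segment_poly !hornerE. Qed.

Lemma half_plane_segment (R : realType) (z : R[i]) (s : R) :
  half_plane z -> 0 <= s <= 1 -> half_plane (segment_poly z).[s%:C%C].
Proof.
rewrite horner_segment /half_plane; case: z => x y; rewrite !eq_complex /=.
move=> /andP[x0 xy0] /andP[s0 s1].
have sx : 0 <= (1 - s) * x by rewrite mulr_ge0 ?subr_ge0.
rewrite !(mul0r, subr0, oppr0, addr0, add0r).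
rewrite addr_ge0 //=; have [s00|s00] := eqVneq s 0.
  by rewrite s00 subr0 !mul1r addr0.
by rewrite gt_eqF // ltr_wpDl // lt_def s00.
Qed.

Lemma half_plane_eigenvalue (R : realType) (m : nat) (M : 'M[R[i]]_m) zs z :
  accretive M -> \det M != 0 -> char_poly M = \prod_(z <- zs) ('X - z%:P) ->
  z \in zs -> half_plane z.
Proof.
move=> hM M0 ME zin; apply/andP; split.
  apply: (accretive_eigenvalue hM).
  by rewrite eigenvalue_root_char ME root_prod_XsubC.
apply: contra M0 => /eqP z0.
have := det_affine_eigenvalues 1 0 ME; rewrite scale1r raddf0 addr0 => ->.
by rewrite prodf_seq_eq0; apply/hasP; exists z; rewrite //= z0 mulr0 addr0.
Qed.

Lemma prod_segment (R : realType) (m : nat) (M : 'M[R[i]]_m) zs s :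
  char_poly M = \prod_(z <- zs) ('X - z%:P) ->
  \prod_(z <- zs) (segment_poly z).[s] = \det ((1 - s) *: M + s%:M).
Proof.
move=> ME; rewrite (det_affine_eigenvalues _ _ ME).
by apply: eq_bigr => z _; rewrite horner_segment.
Qed.

(** This is [accretive_rank1] for the convex combination [(1 - s) M + s], whose
determinant is [q.[s]]; it is nonzero because every factor stays in the
half-plane. *)
Lemma rank1_pencil_half_plane (R : realType) (m : nat) (M : 'M[R[i]]_m) zs u
    (s : R) (q := \prod_(z <- zs) segment_poly z) :
  accretive M -> \det M != 0 -> char_poly M = \prod_(z <- zs) ('X - z%:P) ->
  0 <= s <= 1 ->
  half_plane ((rank1_pencil_poly M u).[s%:C%C] * (q.[s%:C%C])^*%C).
Proof.
move=> hM M0 ME /[dup] sI /andP[s0 s1].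
have qE : q.[s%:C%C] = \det ((1 - s)%:C%C *: M + (s%:C%C)%:M).
  by rewrite horner_prod (prod_segment _ ME) rmorphB.
have q0 : q.[s%:C%C] != 0.
  rewrite horner_prod prodf_seq_neq0; apply/allP => z zin /=.
  by have /andP[] := half_plane_segment (half_plane_eigenvalue hM M0 ME zin) sI.
have NE : rank1_pencil M u s%:C%C =
    (1 - s)%:C%C *: M + (s%:C%C)%:M +
    s%:C%C *: (map_mx (real_complex R) u *m (map_mx (real_complex R) u)^T).
  by rewrite /rank1_pencil scalerDr addrA scale_scalar_mx mulr1 rmorphB.
rewrite qE in q0; rewrite horner_rank1_pencil NE qE /half_plane.
have W0 : 0 < complex.Re (\det ((1 - s)%:C%C *: M + (s%:C%C)%:M +
    s%:C%C *: (map_mx (real_complex R) u *m (map_mx (real_complex R) u)^T)) *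
    (\det ((1 - s)%:C%C *: M + (s%:C%C)%:M))^*%C).
  apply: accretive_rank1 => //; apply: accretiveD.
    by apply: accretiveZ => //; rewrite subr_ge0.
  by rewrite -scalemx1; apply: accretiveZ => //; exact: accretive1.
rewrite ltW //=; apply: contraTneq W0 => ->.
by rewrite /= ltxx.
Qed.

Lemma horner_conj_real (R : realType) (p : {poly R[i]}) (s : R) :
  (map_poly (@conjc R) p).[s%:C%C] = (p.[s%:C%C])^*%C.
Proof. by rewrite -[in LHS](conjc_real s) horner_map. Qed.

Lemma det_rank1_pencil1 (R : realType) (m : nat) (M : 'M[R[i]]_m) u :
  0 < \det (rank1_pencil M u 1).
Proof.
rewrite /rank1_pencil subrr scale0r add0r scale1r det_1_add_outer.
rewrite ltr_pwDl // mxE sumr_ge0 // => j _; rewrite !mxE -rmorphM lecR.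
by rewrite -expr2 sqr_ge0.
Qed.

(** The common determinant [W] of the two pencils stays within a right angle of
the product [q] for [M] and of the product [q'] for [M'], and is a positive
multiple of both at times [0] and [1]; so the arguments of [q] and [q'] vary by
the same amount. *)
Lemma sum_arg_eigenvalues_eq (R : realType) (m : nat) (M M' : 'M[R[i]]_m)
    (zs zs' : seq R[i]) (u u' : 'cV[R]_m) :
  accretive M -> accretive M' -> \det M != 0 -> \det M' != 0 ->
  char_poly M = \prod_(z <- zs) ('X - z%:P) ->
  char_poly M' = \prod_(z <- zs') ('X - z%:P) ->
  (forall s, \det (rank1_pencil M u s) = \det (rank1_pencil M' u' s)) ->
  \sum_(z <- zs) arg z = \sum_(z <- zs') arg z.
Proof.
move=> hM hM' M0 M0' ME ME' detE.
have hz z := half_plane_eigenvalue hM M0 ME (z := z).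
have hz' z := half_plane_eigenvalue hM' M0' ME' (z := z).
pose q := \prod_(z <- zs) segment_poly z.
pose q' := \prod_(z <- zs') segment_poly z.
pose W := rank1_pencil_poly M u.
have WE s : W.[s] = (rank1_pencil_poly M' u').[s].
  rewrite /W.
  rewrite [LHS](horner_rank1_pencil M u s).
  rewrite [RHS](horner_rank1_pencil M' u' s).
  exact: detE.
have hW s : 0 <= s <= 1 -> half_plane (W.[s%:C%C] * (q.[s%:C%C])^*%C).
  exact: rank1_pencil_half_plane.
have hW' s : 0 <= s <= 1 -> half_plane (W.[s%:C%C] * (q'.[s%:C%C])^*%C).
  by rewrite WE; exact: rank1_pencil_half_plane.
pose cj := map_poly (@conjc R).
(* The product of these paths is [|W|^2 |q|^2 |q'|^2] at real times. *)
pose ps := (cj W * q) :: (W * cj q') ::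
  map (@segment_poly R) zs' ++ map (cj \o @segment_poly R) zs.
have q0 : q.[0] = \det M.
  by rewrite horner_prod (prod_segment _ ME) subr0 scale1r raddf0 addr0.
have q0' : q'.[0] = \det M'.
  by rewrite horner_prod (prod_segment _ ME') subr0 scale1r raddf0 addr0.
have W0 : W.[0] = \det M.
  by rewrite horner_rank1_pencil /rank1_pencil subr0 scale1r scale0r addr0.
have W0' : W.[0] = \det M'.
  by rewrite WE horner_rank1_pencil /rank1_pencil subr0 scale1r scale0r addr0.
have C0 : 0 = (0 : R)%:C%C :> R[i] by [].
have C1 : 1 = (1 : R)%:C%C :> R[i] by [].
have cj0 p : (cj p).[0] = (p.[0])^*%C by rewrite C0 horner_conj_real.
have cj1 p : (cj p).[1] = (p.[1])^*%C by rewrite C1 horner_conj_real.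
have segment1 z : (segment_poly z).[1] = 1 :> R[i].
  by rewrite horner_segment subrr mul0r add0r.
have q1 : q.[1] = 1 by rewrite horner_prod big1.
have q1' : q'.[1] = 1 by rewrite horner_prod big1.
have W1 : 0 < W.[1] by rewrite horner_rank1_pencil det_rank1_pencil1.
have := @sum_arg_homotopy R ps.
rewrite {4}/ps !big_cons big_cat !big_map /= => H.
have {H} : arg (cj W * q).[0] + (arg (W * cj q').[0] +
    (\sum_(z <- zs') arg (segment_poly z).[0] +
     \sum_(z <- zs) arg (cj (segment_poly z)).[0])) = 0.
  apply: H => [p s|p|s sI].
  - move=> + sI; rewrite !inE mem_cat => /or4P[/eqP->|/eqP->| |].
    + rewrite hornerM horner_conj_real mulrC -[q.[_]]conjcK -rmorphM mulrC.
      by apply: half_plane_conj; exact: hW.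
    + by rewrite hornerM horner_conj_real; exact: hW'.
    + by move=> /mapP[z zin ->]; apply: half_plane_segment => //; exact: hz'.
    + move=> /mapP[z zin ->] /=; rewrite horner_conj_real.
      by apply/half_plane_conj/half_plane_segment => //; exact: hz.
  - rewrite !inE mem_cat => /or4P[/eqP->|/eqP->| |].
    + rewrite hornerM cj1 q1 mulr1; move: W1.
      by case: (W.[1]) => a b; rewrite !ltcE /= eqr_oppLR oppr0.
    + by rewrite hornerM cj1 q1' conjc1 mulr1.
    + by move=> /mapP[z zin ->]; rewrite segment1 ltr01.
    + by move=> /mapP[z zin ->] /=; rewrite cj1 segment1 conjc1 ltr01.
  - rewrite !big_cons big_cat !big_map /= -horner_prod -/q'.
    rewrite [X in _ * (_ * (_ * X))](_ : _ = (q.[s%:C%C])^*%C); last first.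
      rewrite horner_prod rmorph_prod; apply: eq_bigr => z _.
      exact: horner_conj_real.
    rewrite !hornerM !horner_conj_real.
    set w := W.[_]; set x := q.[_]; set y := q'.[_].
    have -> : w^*%C * x * (w * y^*%C * (y * x^*%C)) =
       (w * w^*%C) * (x * x^*%C) * (y * y^*%C) by ring.
    have /andP[_] := hW _ sI; have /andP[_] := hW' _ sI.
    rewrite -/w -/x -/y !mulf_eq0 !conjc_eq0 !negb_or.
    move=> /andP[w0 y0] /andP[_ x0].
    by apply: mulr_gt0; [apply: mulr_gt0|]; exact: mulC_conj_gt0.
(* At time [0] both comparison terms are squared norms of determinants. *)
rewrite [(cj W * q).[0]]hornerM [(W * cj q').[0]]hornerM !cj0.
rewrite q0 {1}W0 W0' q0' [_^*%C * _]mulrC.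
rewrite !(arg_gt0 (mulC_conj_gt0 _)) // !add0r => /eqP.
have -> : \sum_(z <- zs') arg (segment_poly z).[0] = \sum_(z <- zs') arg z.
  by apply: eq_bigr => z _; rewrite horner_segment subr0 mul1r addr0.
have -> : \sum_(z <- zs) arg (cj (segment_poly z)).[0] = - \sum_(z <- zs) arg z.
  rewrite -sumrN; apply: eq_big_seq => z zin.
  by rewrite cj0 horner_segment subr0 mul1r addr0 arg_conj // hz.
by rewrite subr_eq0 => /eqP ->.
Qed.

(** * Shears of the space-time matrix *)

Lemma symmetricmxP (R : realType) (m : nat) (A : 'M[R]_m) :
  reflect (A^T = A) (A \is symmetricmx).
Proof.
apply: (iffP (is_hermitianmxP _ _ _)); rewrite expr0 scale1r => AE.
  by rewrite {2}AE; apply/matrixP => i j; rewrite !mxE.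
by rewrite -[LHS]AE; apply/matrixP => i j; rewrite !mxE.
Qed.

Definition shear_mx (R : nzRingType) (n : nat) (V : 'cV[R]_n) : 'M[R]_(1 + n) :=
  block_mx 1%:M 0 V 1%:M.

Lemma shearE (R : realType) (n : nat) (V : 'cV[R]_n) (A : 'M[R]_(1 + n)) :
  shear V A = shear_mx V *m A *m (shear_mx V)^T.
Proof. by rewrite /shear /shear_mx tr_block_mx !trmx1 trmx0. Qed.

Lemma det_shear_mx (R : comNzRingType) (n : nat) (V : 'cV[R]_n) :
  \det (shear_mx V) = 1.
Proof. by rewrite det_lblock !det1 mulr1. Qed.

Lemma shear_mxM (R : nzRingType) (n : nat) (V W : 'cV[R]_n) :
  shear_mx V *m shear_mx W = shear_mx (V + W).
Proof.
by rewrite mulmx_block !mul1mx !mulmx1 !mul0mx !mulmx0 !addr0 add0r.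
Qed.

Lemma shearK (R : realType) (n : nat) (V : 'cV[R]_n) (A : 'M[R]_(1 + n)) :
  shear (- V) (shear V A) = A.
Proof.
rewrite !shearE !mulmxA shear_mxM -mulmxA -trmx_mul shear_mxM addNr.
by rewrite /shear_mx -scalar_mx_block trmx1 mul1mx mulmx1.
Qed.

Lemma shear_sym (R : realType) (n : nat) (V : 'cV[R]_n) (A : 'M[R]_(1 + n)) :
  A \is symmetricmx -> shear V A \is symmetricmx.
Proof.
move=> /symmetricmxP As; apply/symmetricmxP.
by rewrite shearE !trmx_mul trmxK As mulmxA.
Qed.

(** Both the degenerate matrices and [spaceI] have this shape. *)
Lemma shear_block0 (R : realType) (n : nat) (V : 'cV[R]_n) (B : 'M[R]_n) :
  shear V (block_mx 0 0 0 B) = block_mx 0 0 0 B.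
Proof.
rewrite /shear !mulmx_block.
by rewrite !(mul1mx, mulmx1, mul0mx, mulmx0, addr0, add0r).
Qed.

Definition lift_mx (R : realType) (n : nat) (A : 'M[R]_(1 + n)) :
    'M[R[i]]_(1 + n) :=
  map_mx (real_complex R) (spaceI R n) +
  Complex 0 1 *: map_mx (real_complex R) A.

Lemma lift_shear (R : realType) (n : nat) (V : 'cV[R]_n) (A : 'M[R]_(1 + n))
    (P := map_mx (real_complex R) (shear_mx V)) :
  lift_mx (shear V A) = P *m lift_mx A *m P^T.
Proof.
have spaceI_shear : shear V (spaceI R n) = spaceI R n := shear_block0 V 1%:M.
rewrite /lift_mx -{1}spaceI_shear !shearE.
rewrite !map_mxM map_trmx -/P mulmxDr mulmxDl.
by rewrite -scalemxAr -scalemxAl.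
Qed.

Lemma hform_spaceI (R : realType) (n : nat) (w : 'rV[R[i]]_(1 + n)) :
  hform (map_mx (real_complex R) (spaceI R n)) w =
  (rsubmx w *m conjT (rsubmx w)) 0 0.
Proof.
rewrite /hform /spaceI map_block_mx !map_mx0 map_mx1 -{1 2}[w]hsubmxK.
rewrite mul_row_block !(mulmx0, mulmx1, addr0, add0r).
by rewrite /conjT map_row_mx tr_row_mx mul_row_col mul0mx add0r.
Qed.

(** The form of [A] is real and is multiplied by [i], so only [spaceI]
contributes to the real part. *)
Lemma Re_hform_lift (R : realType) (n : nat) (A : 'M[R]_(1 + n)) w :
  A \is symmetricmx ->
  complex.Re (hform (lift_mx A) w) =
  complex.Re ((rsubmx w *m conjT (rsubmx w)) 0 0).
Proof.
move=> /symmetricmxP As; rewrite hformD hformZ hform_spaceI.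
have := hform_real_sym w As; case: (hform _ w) => a b /= ->.
by case: (_ 0 0) => c d /=; rewrite mul0r mulr0 subr0 addr0.
Qed.

Lemma accretive_lift (R : realType) (n : nat) (A : 'M[R]_(1 + n)) :
  A \is symmetricmx -> accretive (lift_mx A).
Proof.
move=> As w; rewrite Re_hform_lift //.
by have := hnorm_ge0 (rsubmx w); rewrite lecE => /andP[].
Qed.

(** If [w] is in the left kernel of [lift_mx A], then the form of [lift_mx A] at
[w] is zero, so by [Re_hform_lift] only the first coordinate of [w] is nonzero.
The equation then says that the first row of [A] vanishes; by symmetry so does
the first column. *)
Lemma det_lift_neq0 (R : realType) (n : nat) (A : 'M[R]_(1 + n)) :
  A \is symmetricmx -> A \notin @degenerate R n -> \det (lift_mx A) != 0.
Proof.
move=> As; apply: contra => /eqP/eqP/det0P[w w0 wA0].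
rewrite inE; exists (drsubmx A).
  move/symmetricmxP: As => As; apply/symmetricmxP.
  by rewrite trmx_drsub As.
have wr0 : rsubmx w = 0.
  apply: hnorm_eq0; have := hnorm_ge0 (rsubmx w).
  have := Re_hform_lift w As; rewrite /hform wA0 mul0mx mxE /=.
  case: (_ 0 0) => a b /= <-; rewrite lecE /= => /andP[/eqP -> _].
  by [].
have wE : w = row_mx (lsubmx w) 0 by rewrite -wr0 hsubmxK.
have l0 : lsubmx w 0 0 != 0.
  apply: contra w0 => /eqP l0; rewrite wE.
  have -> : lsubmx w = 0.
    by apply/matrixP => i j; rewrite (ord1 i) (ord1 j) l0 mxE.
  by rewrite row_mx0.
have u0 : usubmx A = 0.
  apply/matrixP => i j; rewrite ord1 [RHS]mxE.
  have : (w *m lift_mx A) 0 j = 0 by rewrite wA0 mxE.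
  have -> : w *m lift_mx A =
      Complex 0 1 *: (lsubmx w *m map_mx (real_complex R) (usubmx A)).
    rewrite {1}wE /lift_mx mulmxDr -scalemxAr /spaceI map_block_mx !map_mx0.
    rewrite mul_row_block !(mulmx0, mul0mx, addr0) row_mx0 add0r.
    by rewrite -{1}[A]vsubmxK map_col_mx mul_row_col mul0mx addr0.
  rewrite !mxE big_ord1 !mxE => /eqP; rewrite !mulf_eq0.
  rewrite !mxE in l0; rewrite (negPf l0) eq_complex /= eqxx oner_eq0 /=.
  by move=> /eqP[].
have ur0 : ursubmx A = 0 by rewrite /ursubmx u0 linear0.
have dl0 : dlsubmx A = 0.
  by move/symmetricmxP: As => As; rewrite -As -trmx_ursub ur0 trmx0.
have ul0 : ulsubmx A = 0 by rewrite /ulsubmx u0 linear0.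
by rewrite -[LHS]submxK ul0 ur0 dl0.
Qed.

Lemma char_poly_eigenvalues (R : realType) (m : nat) (M : 'M[R[i]]_m) :
  char_poly M = \prod_(z <- eigenvalues M) ('X - z%:P).
Proof.
have [zs ME] := closed_field_poly_normal (char_poly M).
rewrite (monicP (char_poly_monic M)) scale1r in ME.
exact: (@xgetPex _ [::]
  [set s | char_poly M = \prod_(z <- s) ('X - z%:P)]%classic
  (ex_intro _ zs ME)).
Qed.

(** The congruence by [P = shear_mx V] sends [1] to [P P^T], which differs from
[1] by a matrix of rank at most two.  Adding one suitable rank one matrix on
each side restores the equality: [P] maps [(1, - V)] to the first basis vector
[e], and [P P^T + e e^T = 1 + (1, V) (1, V)^T]. *)
Lemma shear_rank1 (R : realType) (n : nat) (V : 'cV[R]_n) :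
  shear V (1%:M + col_mx 1%:M (- V) *m (col_mx 1%:M (- V))^T) =
  1%:M + col_mx 1%:M V *m (col_mx 1%:M V)^T.
Proof.
rewrite shearE mulmxDr mulmxDl mulmx1 !mulmxA -mulmxA -trmx_mul.
have -> : shear_mx V *m col_mx 1%:M (- V) = col_mx 1%:M 0.
  rewrite /shear_mx mul_block_col !mul1mx mul0mx mulmx1 addr0.
  by rewrite subrr.
rewrite /shear_mx tr_block_mx !tr_col_mx mulmx_block !mul_col_row.
rewrite !(trmx1, trmx0, mul1mx, mulmx1, mul0mx, mulmx0, addr0, add0r).
rewrite scalar_mx_block !add_block_mx !(addr0, add0r).
by rewrite [X in block_mx _ _ _ X]addrC.
Qed.

Lemma det_pencil_shear (R : realType) (n : nat) (V : 'cV[R]_n)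
    (A : 'M[R]_(1 + n)) (s : R[i]) :
  \det (rank1_pencil (lift_mx A) (col_mx 1%:M (- V)) s) =
  \det (rank1_pencil (lift_mx (shear V A)) (col_mx 1%:M V) s).
Proof.
pose P := map_mx (real_complex R) (shear_mx V).
have detP : \det P = 1 by rewrite det_map_mx det_shear_mx rmorph1.
suff -> : rank1_pencil (lift_mx (shear V A)) (col_mx 1%:M V) s =
    P *m rank1_pencil (lift_mx A) (col_mx 1%:M (- V)) s *m P^T.
  by rewrite !det_mulmx det_tr detP mul1r mulr1.
rewrite /rank1_pencil lift_shear -/P.
rewrite !map_trmx -!map_mxM -(map_mx1 (real_complex R)) -!map_mxD.
rewrite -shear_rank1 shearE !map_mxM -map_trmx -/P.
move: (lift_mx A) (map_mx _ (1%:M + _)) => X Y.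
by rewrite mulmxDr mulmxDl -!scalemxAr -!scalemxAl.
Qed.

Theorem lemma4p4 (R : realType) (n : nat) (n_ge1 : (1 <= n)%N)
  (A : 'M[R]_(1 + n)) (A_sym : A \is symmetricmx) (V : 'cV[R]_n) :
  shear V A \is symmetricmx /\ Theta A = Theta (shear V A).
Proof.
split; first exact: shear_sym.
have [Adeg|Andeg] := boolP (A \in @degenerate R n).
  by have := Adeg; rewrite inE => -[B _ ->]; rewrite shear_block0.
have SAndeg : shear V A \notin @degenerate R n.
  apply: contra Andeg => SAdeg.
  have := SAdeg; rewrite !inE => -[B Bs SAE].
  by exists B; rewrite // -(shearK V A) SAE shear_block0.
rewrite /Theta (negPf Andeg) (negPf SAndeg).
apply: (sum_arg_eigenvalues_eq (M := lift_mx A) (M' := lift_mx (shear V A))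
  (u := col_mx 1%:M (- V)) (u' := col_mx 1%:M V)).
- exact: accretive_lift.
- by apply: accretive_lift; exact: shear_sym.
- exact: det_lift_neq0.
- by apply: det_lift_neq0 => //; exact: shear_sym.
- exact: char_poly_eigenvalues.
- exact: char_poly_eigenvalues.
- by move=> s; exact: det_pencil_shear.
Qed.
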